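(* Let $G$ be a group, $\mathcal{A}$ a unital $C^\ast$-algebra, $\tau$ an action of $G$ on $\mathcal{A}$ by unital $C^\ast$-automorphisms, $\mathcal{H}$ a Hilbert space and $\phi\in\mathrm{UCP}^{G_\tau}(\mathcal{A},\mathcal{B}(\mathcal{H}))$. The following are equivalent: (1) $\phi$ is a $C^\ast$-extreme point of $\mathrm{UCP}^{G_\tau}(\mathcal{A},\mathcal{B}(\mathcal{H}))$; (2) for every $\psi\in\mathrm{CP}^{G_\tau}(\mathcal{A},\mathcal{B}(\mathcal{H}))$ with $\psi\le\phi$ and $\psi(1_\mathcal{A})$ invertible, there exists an invertible $Z\in\mathcal{B}(\mathcal{H})$ such that $\psi(a)=Z^\ast\phi(a)Z$ for all $a\in\mathcal{A}$.
   Context: $\mathrm{CP}^{G_\tau}(\mathcal{A},\mathcal{B}(\mathcal{H}))$ is the set of completely positive maps $\psi:\mathcal{A}\to\mathcal{B}(\mathcal{H})$ with $\psi(\tau_g(a))=\psi(a)$ for all $g\in G,a\in\mathcal{A}$; $\mathrm{UCP}^{G_\tau}(\mathcal{A},\mathcal{B}(\mathcal{H}))$ is its subset of unital maps. $\psi\le\phi$ means $\phi-\psi$ is completely positive. A $C^\ast$-convex combination is $\sum_iT_i^\ast\phi_i(\cdot)T_i$ with $T_i\in\mathcal{B}(\mathcal{H})$, $\sum_iT_i^\ast T_i=\mathrm{Id}_\mathcal{H}$; proper if all $T_i$ invertible. $\phi$ is a $C^\ast$-extreme point of $\mathrm{UCP}^{G_\tau}(\mathcal{A},\mathcal{B}(\mathcal{H}))$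 if whenever $\phi$ is a proper $C^\ast$-convex combination of elements $\phi_i$ of this set, there exist unitaries $U_i$ on $\mathcal{H}$ with $\phi_i=U_i^\ast\phi(\cdot)U_i$ for all $i$. *)

(* Defs.v *)
From HB Require Import structures.
From mathcomp Require Import all_boot all_order all_algebra.
From mathcomp Require Import all_classical all_reals all_analysis.
From mathcomp Require Import complex.
Import numFieldNormedType.Exports.
Import Order.TTheory GRing.Theory Num.Theory.

Set Implicit Arguments.
Unset Strict Implicit.
Unset Printing Implicit Defensive.

Local Open Scope ring_scope.

(** The field of complex numbers, built over an abstract real field R. *)
Definition Cplx (R : realType) : numClosedFieldType := R[i].

Section OperatorDefs.
Variable R : realType.
Local Notation C := (Cplx R).

(** ** Unital C*-algebras.
   The carrier [A] is a Banach space over C (a complete normed C-module);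
   the product, unit and involution are given as operations satisfying the
   axioms of a unital C*-algebra. *)
Section CStar.
Variable A : completeNormedModType C.
Variables (mulA : A -> A -> A) (oneA : A) (starA : A -> A).

Definition unital_cstar_algebra : Prop :=
  (forall x y z, mulA x (mulA y z) = mulA (mulA x y) z) /\
  (forall (c : C) x y z, mulA (c *: x + y) z = c *: mulA x z + mulA y z) /\
  (forall (c : C) x y z, mulA z (c *: x + y) = c *: mulA z x + mulA z y) /\
  (forall x, mulA oneA x = x /\ mulA x oneA = x) /\
  (forall (c : C) x y, starA (c *: x + y) = c^* *: starA x + starA y) /\
  (forall x, starA (starA x) = x) /\
  (forall x y, starA (mulA x y) = mulA (starA y) (starA x)) /\
  (forall x y, `|mulA x y| <= `|x| * `|y|) /\
  (forall x, `|mulA (starA x) x| = `|x| ^+ 2).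

(** Unital *-automorphisms of A. *)
Definition unital_star_automorphism (f : A -> A) : Prop :=
  [/\ (forall (c : C) x y, f (c *: x + y) = c *: f x + f y),
      (forall x y, f (mulA x y) = mulA (f x) (f y)),
      f oneA = oneA,
      (forall x, f (starA x) = starA (f x)) &
      bijective f].

(** An action of the group G on A by unital *-automorphisms. *)
Definition cstar_action (G : groupType) (tau : G -> A -> A) : Prop :=
  [/\ (forall g, unital_star_automorphism (tau g)),
      (forall x, tau 1%g x = x) &
      (forall g h x, tau (g * h)%g x = tau g (tau h x))].

(** Positive elements of the matrix algebra M_n(A): those of the form Y^* Y. *)
Definition pos_mx (n : nat) (X : 'M[A]_n) : Prop :=
  exists Y : 'M[A]_n,
    forall i j, X i j = \sum_(k < n) mulA (starA (Y k i)) (Y k j).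
End CStar.

(** ** Hilbert spaces and bounded operators.
   A Hilbert space is a complete normed C-module whose norm comes from an
   inner product (linear in the first variable, conjugate-symmetric). *)
Section Hilbert.
Variable H : completeNormedModType C.
Variable inner : H -> H -> C.

Definition hilbert_inner : Prop :=
  [/\ (forall (c : C) x y z, inner (c *: x + y) z = c * inner x z + inner y z),
      (forall x y, inner x y = (inner y x)^*) &
      (forall x, `|x| ^+ 2 = inner x x)].

(** T is an element of B(H): a bounded linear operator. *)
Definition bounded_op (T : H -> H) : Prop :=
  (forall (c : C) x y, T (c *: x + y) = c *: T x + T y) /\
  exists M : C, forall x, `|T x| <= M * `|x|.

(** Ts is the adjoint T^* of T. *)
Definition is_adjoint (T Ts : H -> H) : Prop :=
  forall x y, inner (T x) y = inner x (Ts y).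

(** T is invertible in B(H). *)
Definition invertible_op (T : H -> H) : Prop :=
  exists W, bounded_op W /\ (forall x, W (T x) = x) /\ (forall x, T (W x) = x).

(** U is a unitary with adjoint Us. *)
Definition unitary_op (U Us : H -> H) : Prop :=
  [/\ bounded_op U, is_adjoint U Us,
      (forall x, Us (U x) = x) & (forall x, U (Us x) = x)].

(** ** Completely positive maps A -> B(H). *)
Section CP.
Variable A : completeNormedModType C.
Variables (mulA : A -> A -> A) (oneA : A) (starA : A -> A).

(** psi : A -> B(H) is completely positive: linear, B(H)-valued, and for all n
   the amplification psi_n maps positive elements of M_n(A) to positive
   operators on H^n (positivity of an operator S meaning <S h, h> >= 0). *)
Definition completely_positive (psi : A -> H -> H) : Prop :=
  [/\ (forall a, bounded_op (psi a)),
      (forall (c : C) a b x, psi (c *: a + b) x = c *: psi a x + psi b x) &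
      (forall (n : nat) (X : 'M[A]_n), pos_mx mulA starA X ->
         forall h : 'I_n -> H,
           0 <= \sum_(i < n) \sum_(j < n) inner (psi (X i j) (h j)) (h i))].

Variables (G : groupType) (tau : G -> A -> A).

(** CP^{G_tau}(A, B(H)). *)
Definition CP_G (psi : A -> H -> H) : Prop :=
  completely_positive psi /\ (forall g a, psi (tau g a) = psi a).

(** UCP^{G_tau}(A, B(H)). *)
Definition UCP_G (psi : A -> H -> H) : Prop :=
  CP_G psi /\ (forall x, psi oneA x = x).

(** psi <= phi : phi - psi is completely positive. *)
Definition cp_le (psi phi : A -> H -> H) : Prop :=
  completely_positive (fun a x => phi a x - psi a x).

(** phi is a C*-extreme point of UCP^{G_tau}(A, B(H)): whenever
   phi = sum_i T_i^* phi_i(.) T_i is a proper C*-convex combination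
   (finitely many T_i invertible in B(H), sum_i T_i^* T_i = Id) of elements
   phi_i of UCP^{G_tau}(A, B(H)), each phi_i is unitarily equivalent to phi. *)
Definition cstar_extreme (phi : A -> H -> H) : Prop :=
  forall (n : nat) (T Ts : 'I_n -> H -> H) (phis : 'I_n -> A -> H -> H),
    (forall i, bounded_op (T i)) ->
    (forall i, is_adjoint (T i) (Ts i)) ->
    (forall i, invertible_op (T i)) ->
    (forall x, \sum_(i < n) Ts i (T i x) = x) ->
    (forall i, UCP_G (phis i)) ->
    (forall a x, phi a x = \sum_(i < n) Ts i (phis i a (T i x))) ->
    forall i, exists U Us, unitary_op U Us /\
      (forall a x, phis i a x = Us (phi a (U x))).
End CP.
End Hilbert.
End OperatorDefs.

(* Main.v *)
(** (2) => (1): if phi = sum_j T_j^* phi_j T_j, then psi = T_i^* phi_i T_i is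
    dominated by phi, so psi = Z^* phi Z with Z invertible; comparing values at 1
    gives Z^* Z = T_i^* T_i, so U = Z T_i^-1 is unitary and phi_i = U^* phi U.

    (1) => (2): replace psi by chi = psi/2, so that both chi(1) and 1 - chi(1) are
    positive and invertible, with square roots T_1 and T_2. Then phi is the proper
    C*-convex combination of T_1^-1 chi T_1^-1 and T_2^-1 (phi - chi) T_2^-1, and
    extremality gives chi = T_1 U^* phi U T_1, that is, Z = sqrt 2 U T_1.

    The square root of 1 - S, for 0 <= S <= s < 1, is 1 - Y, where Y is the fixed
    point of the contraction Y |-> (S + Y^2)/2 of the ball of radius s; it is
    invertible by a Neumann series. *)

Require Import Defs.
From HB Require Import structures.
From mathcomp Require Import all_boot all_order all_algebra.
From mathcomp Require Import all_classical all_reals all_analysis.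
From mathcomp Require Import complex.
From mathcomp Require Import ring.
Import numFieldNormedType.Exports.
Import Order.TTheory GRing.Theory Num.Theory.
Local Open Scope ring_scope.

Set Implicit Arguments.
Unset Strict Implicit.
Unset Printing Implicit Defensive.

(** * Limits at a geometric rate *)

Section GeometricBounds.
Variable R : realType.
Local Notation C := (Cplx R).
Implicit Types (a s K : C).

Lemma real_geom_le0 (a s K : R) : 0 <= s -> s < 1 ->
  (forall n, a <= K * s ^+ n) -> a <= 0.
Proof.
move=> s0 s1 ha.
have cvgK : (K * s ^+ n @[n --> \oo] --> K * 0)%classic.
  by apply: cvgMl_tmp; apply: cvg_expr; rewrite ger0_norm.
rewrite -(mulr0 K); apply: (cvgr_to_ge cvgK).
by exists 0%N => // n _; exact: ha.
Qed.

(** Nonnegative complex numbers are real, so [a], [s] and [K] all come from [R], where the limit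
    argument applies. *)
Lemma geom_le0 a s K : a \is Num.real -> 0 <= s -> s < 1 -> 0 <= K ->
  (forall n, a <= K * s ^+ n) -> a <= 0.
Proof.
move=> /complex_realP[x ->] s0 s1 K0.
have /complex_realP[t def_s] := ger0_real s0.
have /complex_realP[k ->] := ger0_real K0.
move: s0 s1; rewrite def_s -(rmorph1 (real_complex R)) -(rmorph0 (real_complex R)).
rewrite lecR ltcR => t0 t1 ha; rewrite lecR.
by apply: (real_geom_le0 t0 t1 (K := k)) => n; rewrite -lecR rmorphM rmorphXn.
Qed.

(** Identities for a limit are proved through this: the defect is compared with stage [n] of the
    approximation and is O(s^n) for every [n]. *)
Lemma geom_eq0 (V : normedZmodType C) (v : V) s K : 0 <= s -> s < 1 ->
  (forall n, `|v| <= K * s ^+ n) -> v = 0.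
Proof.
move=> s0 s1 hv; have K0 : 0 <= K.
  by rewrite -(mulr1 K) -(expr0 s) (le_trans _ (hv 0%N)).
by apply/eqP; rewrite -normr_le0; apply: geom_le0 hv.
Qed.

Lemma geom_small s K e : 0 <= s -> s < 1 -> 0 <= K -> 0 < e ->
  exists n, K * s ^+ n < e.
Proof.
move=> s0 s1 K0 e0; apply: contrapT => /forallNP h.
suff : e <= 0 by move/le_gtF; rewrite e0.
apply: (geom_le0 (gtr0_real e0) s0 s1 K0) => n.
have Ksn_real : K * s ^+ n \is Num.real by rewrite ger0_real// mulr_ge0 ?exprn_ge0.
by rewrite (real_leNgt (gtr0_real e0) Ksn_real); apply/negP/h.
Qed.

(** The factor [1 - s] makes the step bound telescope as [K * s ^+ n - K * s ^+ n.+1], so the tails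
    are controlled with the same constant [K]. *)
Lemma geom_cvg (V : completeNormedModType C) (u : nat -> V) s K :
  0 <= s -> s < 1 -> 0 <= K ->
  (forall n, `|u n.+1 - u n| <= K * (1 - s) * s ^+ n) ->
  exists l, forall n, `|u n - l| <= K * s ^+ n.
Proof.
move=> s0 s1 K0 hu.
have tail n k : `|u (n + k)%N - u n| <= K * s ^+ n - K * s ^+ (n + k)%N.
  elim: k => [|k IH]; first by rewrite addn0 !subrr normr0.
  rewrite addnS -(subrK (u (n + k)%N) (u _.+1)) -addrA.
  apply: le_trans (ler_normD _ _) _; apply: le_trans (lerD (hu _) IH) _.
  by rewrite exprS le_eqVlt; apply/orP; left; apply/eqP; ring.
have tail_le n k : `|u n - u (n + k)%N| <= K * s ^+ n.
  rewrite distrC; apply: le_trans (tail n k) _.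
  by rewrite gerBl mulr_ge0 ?exprn_ge0.
have /cauchy_cvgP cvg_u : cauchy (u @ \oo)%classic.
  apply/cauchyP => e e0; have [n Kn] := geom_small s0 s1 K0 e0.
  exists (u n); exists n => // m /= nm.
  by rewrite -ball_normE /= (le_lt_trans _ Kn)// -(subnKC nm).
(* The tail bound passes to the limit by inserting a term [u (n + N)] within [e] of it. *)
exists (lim (u @ \oo)%classic) => n; apply/ler_addgt0Pr => e e0.
have /cvgrPdist_le/(_ e e0)[N _ hN] := cvg_u.
rewrite -(subrK (u (n + N)%N) (u n)) -addrA.
apply: le_trans (ler_normD _ _) _; apply: lerD => //.
by rewrite distrC; apply: hN => /=; exact: leq_addl.
Qed.

End GeometricBounds.

(** * Inner products, positive operators and bounded operators *)

Section BoundedOperators.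
Variable R : realType.
Local Notation C := (Cplx R).
Variables (H : completeNormedModType C) (inner : H -> H -> C).
Hypothesis hH : hilbert_inner inner.
Implicit Types (x y z : H) (S T U W Y : H -> H) (s M : C).

Lemma ipDl x y z : inner (x + y) z = inner x z + inner y z.
Proof. by case: hH => hl _ _; rewrite -(scale1r x) hl mul1r scale1r. Qed.

Lemma ip0l x : inner 0 x = 0.
Proof. by apply: (@addrI _ (inner 0 x)); rewrite -ipDl !addr0. Qed.

Lemma ipZl (c : C) x y : inner (c *: x) y = c * inner x y.
Proof. by case: hH => hl _ _; rewrite -(addr0 (c *: x)) hl ip0l addr0. Qed.

Lemma ipC x y : inner x y = (inner y x)^*.
Proof. by case: hH. Qed.

Lemma ip_norm x : inner x x = `|x| ^+ 2.
Proof. by case: hH. Qed.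

Lemma ipBl x y z : inner (x - y) z = inner x z - inner y z.
Proof. by rewrite ipDl -scaleN1r ipZl mulN1r. Qed.

Lemma ipDr x y z : inner x (y + z) = inner x y + inner x z.
Proof. by rewrite ipC ipDl rmorphD /= -!ipC. Qed.

Lemma ipZr (c : C) x y : inner x (c *: y) = c^* * inner x y.
Proof. by rewrite ipC ipZl rmorphM /= -ipC. Qed.

Lemma ipBr x y z : inner x (y - z) = inner x y - inner x z.
Proof. by rewrite ipC ipBl rmorphB /= -!ipC. Qed.

Lemma ip0r x : inner x 0 = 0.
Proof. by rewrite ipC ip0l conjC0. Qed.

Lemma ip_inj x y : (forall z, inner x z = inner y z) -> x = y.
Proof.
move=> hxy; apply/eqP; rewrite -subr_eq0 -normr_eq0 -sqrf_eq0 -ip_norm ipBl.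
by rewrite hxy subrr.
Qed.

Lemma ip_injr x y : (forall z, inner z x = inner z y) -> x = y.
Proof. by move=> hxy; apply: ip_inj => z; rewrite !(ipC _ z) hxy. Qed.

(** The vector [x] minus its orthogonal projection onto the line of [y] has nonnegative squared
    norm. *)
Lemma cauchy_schwarz x y : `|inner x y| <= `|x| * `|y|.
Proof.
have [->|y0] := eqVneq y 0; first by rewrite ip0r !normr0 mulr0.
have ny0 : 0 < `|y| by rewrite normr_gt0.
rewrite -ler_sqr ?nnegrE ?mulr_ge0// exprMn.
have : 0 <= inner (x - (inner x y / `|y| ^+ 2) *: y) (x - (inner x y / `|y| ^+ 2) *: y).
  by rewrite ip_norm exprn_ge0.
rewrite ipBl !ipBr !ipZl !ipZr !ip_norm (ipC y x).
rewrite rmorphM fmorphV rmorphXn /= (conj_Creal (normr_real y)).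
set a := inner x y.
rewrite (_ : _ - _ = `|x| ^+ 2 - a * a^* / `|y| ^+ 2); last first.
  by field; rewrite normr_eq0.
by rewrite -normCK subr_ge0 ler_pdivrMr ?exprn_gt0.
Qed.

Lemma pos_op_adjoint S : linear S -> (forall x, 0 <= inner (S x) x) ->
  is_adjoint inner S S.
Proof.
(* Polarization: <S v, v> is real at v = x + y and at v = i x + y. *)
move=> linS posS x y; rewrite (ipC x).
have real_form z : (inner (S z) z)^* = inner (S z) z.
  by rewrite conj_Creal// ger0_real.
have linS1 u v : S (u + v) = S u + S v by rewrite -(scale1r u) linS !scale1r.
have := real_form (x + y); have := real_form ('i *: x + y).
rewrite linS linS1 !ipDl !ipDr !ipZl !ipZr !rmorphD !rmorphM /=.
rewrite !real_form !(conjCK, conjCi).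
set a := inner (S x) y; set b := inner (S y) x.
rewrite (_ : (- 'i)^* = 'i); last by rewrite -conjCi conjCK.
set p := inner (S x) x; set q := inner (S y) y => e1 e2.
(* The vector [x + y] makes [a + b] real and ['i *: x + y] makes ['i * (a - b)] real; adding the two
   relations gives [a = b^*]. *)
have e1' : a^* + b^* = a + b.
  apply: (@addrI _ (p + q)); transitivity (p + a^* + (b^* + q)); first by ring.
  by rewrite e2; ring.
have e2' : b^* - a^* = a - b.
  have : 'i * (b^* - a^*) = 'i * (a - b).
    apply: (@addrI _ (- 'i * ('i * p) + q)).
    transitivity (- 'i * ('i * p) + - 'i * a^* + ('i * b^* + q)); first by ring.
    by rewrite e1; ring.
  exact/mulfI/neq0Ci.
have /mulfI : (2%:R : C) != 0 by rewrite pnatr_eq0.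
apply; rewrite mulr_natl mulr2n.
have -> : a + a = (a + b) + (a - b) by ring.
by rewrite -e1' -e2'; ring.
Qed.

Lemma pos_op_norm_le S s : linear S -> 0 < s ->
  (forall x, 0 <= inner (S x) x <= s * `|x| ^+ 2) ->
  forall x, `|S x| ^+ 2 <= s * inner (S x) x.
Proof.
move=> linS s0 hS x.
have adjS : is_adjoint inner S S.
  by apply: pos_op_adjoint => // y; case/andP: (hS y).
have sR : s^* = s by rewrite conj_Creal ?gtr0_real.
(* Expand <S v, v> >= 0 at v = x - S x / s. *)
set y := S x; have /andP[_ Sy] := hS y.
have /andP[] := hS (x - s^-1 *: y).
rewrite addrC -scaleN1r scalerA linS -/y -/(S y) !ipDl !ipDr !ipZl !ipZr => + _.
rewrite (adjS y x) -/y rmorphM rmorphN rmorph1 fmorphV /= sR ip_norm => h.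
rewrite -subr_ge0.
(* With [inner (S y) y] replaced by its upper bound, multiplication by [s] leaves [s * inner y x]
   minus the squared norm of [y]. *)
have : 0 <= s * (inner y x - 2 * s^-1 * `|y| ^+ 2 + s^-1 ^+ 2 * (s * `|y| ^+ 2)).
  rewrite mulr_ge0 ?(ltW s0)//; apply: le_trans h _.
  have : s^-1 ^+ 2 * inner (S y) y <= s^-1 ^+ 2 * (s * `|y| ^+ 2).
    by rewrite ler_wpM2l// exprn_ge0// invr_ge0 ltW.
  rewrite -(lerD2l (inner y x - 2 * s^-1 * `|y| ^+ 2)); apply: le_trans.
  by rewrite le_eqVlt; apply/orP; left; apply/eqP; ring.
congr (0 <= _); field; exact: lt0r_neq0.
Qed.

(** The constant in [bounded_op] is a complex number whose sign is unknown when [H] is zero; its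
    modulus plus one is a positive bound, safe in products and quotients. *)
Lemma bounded_op_bound T : bounded_op T ->
  exists2 M, 1 <= M & forall x, `|T x| <= M * `|x|.
Proof.
case=> _ [M hM]; exists (`|M| + 1); first by rewrite lerDr.
move=> x; have Mx := hM x; have Mx0 : 0 <= M * `|x| := le_trans (normr_ge0 _) Mx.
by rewrite mulrDl (le_trans Mx)// -(ger0_norm Mx0) normrM normr_id mul1r lerDl.
Qed.

Lemma bounded_opZ T (bT : bounded_op T) (c : C) x : T (c *: x) = c *: T x.
Proof. case: bT => linT _; exact: GRing.scalable_linear linT c x. Qed.

Lemma bounded_op_comp S T : bounded_op S -> bounded_op T ->
  bounded_op (fun x => S (T x)).
Proof.
move=> bS bT; split=> [c x y|]; first by rewrite (proj1 bT) (proj1 bS).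
have [M M1 hM] := bounded_op_bound bS; have [N _ hN] := bounded_op_bound bT.
exists (M * N) => x; rewrite -mulrA (le_trans (hM _))// ler_wpM2l//.
exact: le_trans M1.
Qed.

Lemma bounded_op_scale (c : C) T : bounded_op T -> bounded_op (fun x => c *: T x).
Proof.
move=> bT; split=> [d x y|].
  by rewrite (proj1 bT) scalerDr !scalerA (mulrC c).
have [M _ hM] := bounded_op_bound bT; exists (`|c| * M) => x.
by rewrite normrZ -mulrA ler_wpM2l.
Qed.

Lemma bounded_op_add S T : bounded_op S -> bounded_op T ->
  bounded_op (fun x => S x + T x).
Proof.
move=> bS bT; split=> [c x y|].
  by rewrite (proj1 bT) (proj1 bS) scalerDr addrACA.
have [M _ hM] := bounded_op_bound bS; have [N _ hN] := bounded_op_bound bT.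
by exists (M + N) => x; rewrite mulrDl (le_trans (ler_normD _ _))// lerD.
Qed.

(** The squared norm of [Ts x] is [inner (T (Ts x)) x]; Cauchy-Schwarz and division by the norm of
    [Ts x] give the bound of [T] for [Ts]. *)
Lemma bounded_op_adjoint T Ts : bounded_op T -> is_adjoint inner T Ts ->
  bounded_op Ts.
Proof.
move=> bT adjT; split=> [c x y|].
  by apply: ip_injr => z; rewrite ipDr ipZr -!adjT ipDr ipZr.
have [M M1 hM] := bounded_op_bound bT; exists M => x.
have [->|Tx0] := eqVneq (Ts x) 0.
  by rewrite normr0 mulr_ge0 // (le_trans _ M1).
rewrite -(ler_pM2l (_ : 0 < `|Ts x|)) ?normr_gt0//.
rewrite -expr2 -ip_norm -adjT -(ger0_norm (_ : 0 <= inner (T (Ts x)) x)); last first.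
  by rewrite adjT ip_norm exprn_ge0.
rewrite (le_trans (cauchy_schwarz _ _))// mulrA (mulrC _ M).
by rewrite ler_wpM2r.
Qed.

End BoundedOperators.

(** * Neumann series and square roots of positive operators *)

Section SquareRoot.
Variable R : realType.
Local Notation C := (Cplx R).
Variables (H : completeNormedModType C) (inner : H -> H -> C).
Hypothesis hH : hilbert_inner inner.
Implicit Types (x y z : H) (S T W Y : H -> H) (s M : C).

Definition selfadjoint_inverses T W : Prop :=
  [/\ bounded_op T, bounded_op W, is_adjoint inner T T, cancel T W & cancel W T].

Lemma selfadjoint_inverses_adjoint T W :
  selfadjoint_inverses T W -> is_adjoint inner W W.
Proof. by case=> _ _ adjT _ WK x y; rewrite -{1}(WK y) -adjT WK. Qed.

(** The iterates of [z |-> x + Y z] from [0] are the partial sums of the series of all [Y^k x],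
    whose terms decay like s^k. *)
Lemma neumann Y s : linear Y -> 0 <= s -> s < 1 ->
  (forall x, `|Y x| <= s * `|x|) -> forall x, exists z, z - Y z = x.
Proof.
move=> linY s0 s1 hY x.
have linB := GRing.zmod_morphism_linear linY.
pose u n := iter n (fun z => x + Y z) 0.
have s1' : 0 < 1 - s by rewrite subr_gt0.
have K0 : 0 <= `|x| / (1 - s) by rewrite divr_ge0// ltW.
have [] := @geom_cvg _ _ u s (`|x| / (1 - s)) s0 s1 K0.
  move=> n; rewrite divfK ?gt_eqF//; elim: n => [|n IH].
    by rewrite /u /= subr0 -{1}(subrr 0) linB subrr addr0 mulr1.
  rewrite /u /= -/(u n) -/(u n.+1) opprD addrACA subrr add0r -linB.
  by rewrite (le_trans (hY _))// exprS mulrCA ler_wpM2l.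
move=> z hz; exists z; apply/eqP; rewrite -subr_eq0; apply/eqP.
apply: (@geom_eq0 _ _ _ s (2 * (`|x| / (1 - s)))) => // n.
rewrite (_ : _ - x = - (u n.+1 - z) + Y (u n - z)); last first.
  by rewrite linB /u /= -/(u n) opprB opprD !addrA subrK addrAC.
rewrite (le_trans (ler_normD _ _))// normrN -mulrA mulr_natl mulr2n lerD//.
  by rewrite (le_trans (hz _))// ler_wpM2l// exprS ler_piMl ?exprn_ge0 ?(ltW s1)//.
by rewrite (le_trans (hY _))// (le_trans _ (hz n))// ler_piMl ?(ltW s1)//.
Qed.

(* Its limit Y solves Y = (S + Y^2)/2, that is, (1 - Y)^2 = 1 - S. *)
Fixpoint sqrt_iter S n : H -> H :=
  if n is m.+1 then fun x => 2^-1 *: (S x + sqrt_iter S m (sqrt_iter S m x))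
  else fun=> 0.

Lemma norm_half_le (u v : H) (a : C) : `|u| <= a -> `|v| <= a ->
  `|2^-1 *: (u + v)| <= a.
Proof.
move=> hu hv; rewrite normrZ ger0_norm ?invr_ge0 ?ler0n//.
rewrite mulrC ler_pdivrMr ?ltr0n// mulr_natr mulr2n.
by rewrite (le_trans (ler_normD _ _))// lerD.
Qed.

(** * The fixed-point iteration for the square root *)

Section Iteration.
Variables (S : H -> H) (s : C).
Hypotheses (linS : linear S) (s0 : 0 <= s) (s1 : s < 1).
Hypothesis hS : forall x, `|S x| <= s * `|x|.

Local Notation Y := (sqrt_iter S).

Lemma sqrt_iter_linear n : linear (Y n).
Proof.
elim: n => [|n IH] c x y; first by rewrite /= scaler0 addr0.
by rewrite /= linS !IH addrACA -scalerDr [LHS]scalerDr !scalerA mulrC.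
Qed.

Lemma sqrt_iter_norm n x : `|Y n x| <= s * `|x|.
Proof.
elim: n x => [|n IH] x; first by rewrite normr0 mulr_ge0.
apply: norm_half_le => //; apply: le_trans (IH _) _.
by rewrite ler_wpM2l// (le_trans (IH _))// ler_piMl// ltW.
Qed.

Lemma sqrt_iter_adjoint n : is_adjoint inner S S -> is_adjoint inner (Y n) (Y n).
Proof.
move=> adjS; elim: n => [|n IH] x y; first by rewrite (ip0l hH) (ip0r hH).
rewrite (ipZl hH) (ipZr hH) (ipDl hH) (ipDr hH) adjS !IH.
by rewrite conj_Creal// realV realn.
Qed.

Lemma sqrt_iterS n x : Y n.+1 x = 2^-1 *: (S x + Y n (Y n x)).
Proof. by []. Qed.

(** With D = Y_{n+1} - Y_n, the difference of squares is Y_{n+1} D + D Y_n. Each summand gains a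
    factor [s] over the previous step, and the next step is half their sum. *)
Lemma sqrt_iter_step n x : `|Y n.+1 x - Y n x| <= s * `|x| * s ^+ n.
Proof.
elim: n x => [|n IH] x.
  rewrite subr0 mulr1; apply: norm_half_le => //.
  by rewrite normr0 mulr_ge0.
have linB := GRing.zmod_morphism_linear (sqrt_iter_linear n.+1).
have -> : Y n.+2 x - Y n.+1 x = 2^-1 *: (Y n.+1 (Y n.+1 x) - Y n (Y n x)).
  rewrite (sqrt_iterS n.+1 x) [X in _ - X](sqrt_iterS n x).
  by rewrite -scalerBr opprD addrACA subrr add0r.
rewrite -(subrK (Y n.+1 (Y n x)) (Y n.+1 (Y n.+1 x))) -addrA -linB.
apply: norm_half_le.
  rewrite (le_trans (sqrt_iter_norm _ _))// -mulrA ler_wpM2l//.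
  by rewrite (le_trans (IH _))// exprS mulrA (mulrC s).
rewrite (le_trans (IH _))// exprS mulrA ler_wpM2r ?exprn_ge0//.
by rewrite -mulrA ler_wpM2l// mulrC sqrt_iter_norm.
Qed.

(** The iterates converge pointwise at rate s^n and choice collects the limits into a map. Each
    property passes to it because its defect is O(s^n). *)
Lemma sqrt_iter_fixpoint : is_adjoint inner S S ->
  exists T, [/\ linear T, (forall x, `|T x| <= s * `|x|), is_adjoint inner T T &
    forall x, T x + T x = S x + T (T x)].
Proof.
move=> adjS; pose k := s / (1 - s).
have s1' : 0 < 1 - s by rewrite subr_gt0.
have k0 : 0 <= k by rewrite divr_ge0// ltW.
have /choice[T hT] x : exists l, forall n, `|Y n x - l| <= k * `|x| * s ^+ n.
  apply: geom_cvg => //; first exact: mulr_ge0.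
  have -> : k * `|x| * (1 - s) = s * `|x| by rewrite mulrAC divfK ?gt_eqF.
  by move=> n; exact: sqrt_iter_step.
have T_norm x : `|T x| <= s * `|x|.
  rewrite -subr_le0; apply: (geom_le0 _ s0 s1 (mulr_ge0 k0 (normr_ge0 x))).
    by rewrite realB// ger0_real// mulr_ge0.
  move=> n; rewrite lerBlDr -(subrK (Y n x) (T x)).
  by rewrite (le_trans (ler_normD _ _))// lerD ?sqrt_iter_norm// distrC.
have linT : linear T.
  move=> c x y; apply/eqP; rewrite -subr_eq0; apply/eqP.
  apply: (@geom_eq0 _ _ _ s (k * `|c *: x + y| + (`|c| * (k * `|x|) + k * `|y|))) => // n.
  rewrite (_ : _ - _ = (T (c *: x + y) - Y n (c *: x + y))
      + (c *: (Y n x - T x) + (Y n y - T y))); last first.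
    rewrite sqrt_iter_linear scalerBr [X in _ = _ + X]addrACA -opprD.
    by rewrite addrA subrK.
  rewrite !mulrDl (le_trans (ler_normD _ _))// lerD ?(distrC (T _))//.
  rewrite (le_trans (ler_normD _ _))// lerD// normrZ -mulrA ler_wpM2l//.
exists T; split=> // [x y|x].
- apply/eqP; rewrite -subr_eq0; apply/eqP.
  apply: (@geom_eq0 _ _ _ s (k * `|x| * `|y| + `|x| * (k * `|y|))) => // n.
  rewrite (_ : _ - _ = inner (T x - Y n x) y + inner x (Y n y - T y)); last first.
    by rewrite (ipBl hH) (ipBr hH) sqrt_iter_adjoint// addrA subrK.
  rewrite (le_trans (ler_normD _ _))// mulrDl lerD// (le_trans (cauchy_schwarz hH _ _))//.
    by rewrite mulrAC ler_wpM2r// distrC.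
  by rewrite -mulrA ler_wpM2l.
- have linB n := GRing.zmod_morphism_linear (sqrt_iter_linear n).
  apply/eqP; rewrite -subr_eq0; apply/eqP.
  apply: (@geom_eq0 _ _ _ s (k * `|x| + k * `|x| + (k * `|x| + k * `|x|))) => // n.
  (* The iteration rule expresses [S x] through [Y n.+1] and [Y n]; what remains is four errors,
     each at most k s^n times the norm of [x]. *)
  have -> : T x + T x - (S x + T (T x)) =
    ((T x - Y n.+1 x) + (T x - Y n.+1 x)) + (Y n (Y n x - T x) + (Y n (T x) - T (T x))).
    have -> : S x = Y n.+1 x + Y n.+1 x - Y n (Y n x).
      by rewrite sqrt_iterS -scalerDl -div1r -splitr scale1r addrK.
    have -> : Y n (Y n x - T x) + (Y n (T x) - T (T x)) = Y n (Y n x) - T (T x).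
      by rewrite linB addrA subrK.
    rewrite [X in _ = X + _]addrACA -opprD (opprD (_ - _)) opprB.
    by rewrite (addrC (Y n (Y n x))) -!addrA.
  have step z : `|Y n.+1 z - T z| <= k * `|z| * s ^+ n.
    rewrite (le_trans (hT _ _))// ler_wpM2l ?(mulr_ge0 k0 (normr_ge0 z))//.
    rewrite exprS ler_piMl ?exprn_ge0//.
    exact: ltW.
  rewrite !mulrDl (le_trans (ler_normD _ _))// lerD// (le_trans (ler_normD _ _))//.
    by rewrite lerD// distrC.
  rewrite lerD//.
    by rewrite (le_trans (sqrt_iter_norm _ _))// (le_trans _ (hT x n))// ler_piMl ?(ltW s1)//.
  rewrite (le_trans (hT _ _))// ler_wpM2r ?exprn_ge0// ler_wpM2l//.
  by rewrite (le_trans (T_norm _))// ler_piMl ?(ltW s1)//.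
Qed.

End Iteration.

Lemma pos_op_sqrt S s : linear S -> 0 < s -> s < 1 ->
  (forall x, 0 <= inner (S x) x <= s * `|x| ^+ 2) ->
  exists T W, selfadjoint_inverses T W /\ forall x, T (T x) = x - S x.
Proof.
move=> linS s0 s1 hS.
have adjS : is_adjoint inner S S.
  by apply: (pos_op_adjoint hH) => // x; case/andP: (hS x).
have S_norm x : `|S x| <= s * `|x|.
  rewrite -ler_sqr ?nnegrE ?(mulr_ge0 (ltW s0))// exprMn expr2 -mulrA.
  rewrite (le_trans (pos_op_norm_le hH linS s0 hS x))// ler_wpM2l ?(ltW s0)//.
  by case/andP: (hS x).
have [Y [linY Y_norm adjY Y_fix]] := sqrt_iter_fixpoint linS (ltW s0) s1 S_norm adjS.
have linB := GRing.zmod_morphism_linear linY.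
have s1' : 0 < 1 - s by rewrite subr_gt0.
pose T x := x - Y x.
have linT : linear T.
  by move=> c x y; rewrite /T linY opprD addrACA scalerBr.
(* This lower bound gives the injectivity of [T] and the bound on its inverse; surjectivity comes
   from the Neumann series. *)
have T_lower x : `|x| <= (1 - s)^-1 * `|T x|.
  rewrite ler_pdivlMl// mulrBl mul1r lerBlDr.
  rewrite -{1}(subrK (Y x) x) (le_trans (ler_normD _ _))// lerD//.
have /choice[W WK] := neumann linY (ltW s0) s1 Y_norm.
have injT : injective T.
  move=> x y Txy; apply/eqP; rewrite -subr_eq0 -normr_le0.
  rewrite (le_trans (T_lower _))// (GRing.zmod_morphism_linear linT) Txy subrr.
  by rewrite normr0 mulr0.
exists T, W; split; last first.
  move=> x; have -> : S x = Y x + Y x - Y (Y x) by rewrite Y_fix addrK.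
  by rewrite /T linB -!addrA -opprD.
split.
- split=> //; exists (1 + s) => x.
  by rewrite mulrDl mul1r (le_trans (ler_normB _ _))// lerD.
- split=> [c x y|]; last by exists (1 - s)^-1 => x; rewrite -{2}(WK x).
  by apply: injT; rewrite linT /T !WK.
- by move=> x y; rewrite /T (ipBl hH) (ipBr hH) adjY.
- by move=> x; apply: injT; rewrite /T WK.
- exact: WK.
Qed.

End SquareRoot.

(** * Completely positive maps and their values at the unit *)

Section CompletelyPositive.
Variable R : realType.
Local Notation C := (Cplx R).
Variables (A : completeNormedModType C).
Variables (mulA : A -> A -> A) (oneA : A) (starA : A -> A).
Variables (H : completeNormedModType C) (inner : H -> H -> C).
Hypothesis hH : hilbert_inner inner.
Variables (G : groupType) (tau : G -> A -> A).
Implicit Types (x y z : H) (T Ts U W Z : H -> H) (phi psi : A -> H -> H).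

Local Notation CP := (completely_positive inner mulA starA).
Local Notation CPG := (CP_G inner mulA starA tau).
Local Notation UCPG := (UCP_G inner mulA oneA starA tau).

Lemma is_adjoint_sym T Ts : is_adjoint inner T Ts -> is_adjoint inner Ts T.
Proof. by move=> adjT x y; rewrite (ipC hH) -adjT -(ipC hH). Qed.

(** The quadratic form of the conjugated map at the vectors [h i] is that of [psi] at the vectors
    [T (h i)]. *)
Lemma cp_conjugate psi T Ts : bounded_op T -> is_adjoint inner T Ts -> CP psi ->
  CP (fun a x => Ts (psi a (T x))).
Proof.
move=> bT adjT [bpsi linpsi pospsi].
have bTs := bounded_op_adjoint hH bT adjT.
split=> [a|c a b x|n X posX h].
- apply: (bounded_op_comp bTs); apply: bounded_op_comp => //; exact: bpsi.
- by rewrite linpsi (proj1 bTs).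
- have := pospsi n X posX (fun i => T (h i)); congr (0 <= _).
  apply: eq_bigr => i _; apply: eq_bigr => j _.
  by rewrite (is_adjoint_sym adjT).
Qed.

Lemma cp_scale psi (c : C) : 0 <= c -> CP psi -> CP (fun a x => c *: psi a x).
Proof.
move=> c0 [bpsi linpsi pospsi]; split=> [a|d a b x|n X posX h].
- exact: bounded_op_scale.
- by rewrite linpsi scalerDr !scalerA mulrC.
- have := mulr_ge0 c0 (pospsi n X posX h); congr (0 <= _).
  rewrite mulr_sumr; apply: eq_bigr => i _; rewrite mulr_sumr.
  by apply: eq_bigr => j _; rewrite (ipZl hH).
Qed.

Lemma cp_add phi psi : CP phi -> CP psi -> CP (fun a x => phi a x + psi a x).
Proof.
move=> [bphi linphi posphi] [bpsi linpsi pospsi]; split=> [a|d a b x|n X posX h].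
- exact: bounded_op_add.
- by rewrite linpsi linphi scalerDr addrACA.
- have := addr_ge0 (posphi n X posX h) (pospsi n X posX h); congr (0 <= _).
  rewrite -big_split; apply: eq_bigr => i _; rewrite -big_split.
  by apply: eq_bigr => j _; rewrite (ipDl hH).
Qed.

Lemma cp_zero : CP (fun _ _ => 0).
Proof.
split=> [a|d a b x|n X posX h].
- by split=> [c x y|]; [rewrite scaler0 addr0 | exists 0 => x; rewrite normr0 mul0r].
- by rewrite scaler0 addr0.
- by rewrite !big1// => i _; rewrite big1// => j _; rewrite (ip0l hH).
Qed.

Lemma cp_sum (I : Type) (r : seq I) (P : pred I) (F : I -> A -> H -> H) :
  (forall i, P i -> CP (F i)) -> CP (fun a x => \sum_(i <- r | P i) F i a x).
Proof.
move=> cpF; elim: r => [|i r IH].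
  rewrite (_ : (fun _ => _) = fun _ _ => 0); first exact: cp_zero.
  by apply/funext => a; apply/funext => x; rewrite big_nil.
case Pi : (P i).
  rewrite (_ : (fun _ => _) =
      fun a x => F i a x + \sum_(i <- r | P i) F i a x); last first.
    by apply/funext => a; apply/funext => x; rewrite big_cons Pi.
  by apply: cp_add => //; exact: cpF.
rewrite (_ : (fun _ => _) = fun a x => \sum_(i <- r | P i) F i a x)//.
by apply/funext => a; apply/funext => x; rewrite big_cons Pi.
Qed.

Hypothesis hA : unital_cstar_algebra mulA oneA starA.

Lemma star_one : starA oneA = oneA.
Proof.
have [_ [_ [_ [one [_ [starK [starM _]]]]]]] := hA.
by have := starM (starA oneA) oneA; rewrite starK (proj2 (one _)) starK => <-.
Qed.

(** The one-by-one matrix with entry [oneA] is positive, since 1 = 1^* 1. *)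
Lemma cp_one_ge0 psi x : CP psi -> 0 <= inner (psi oneA x) x.
Proof.
case=> _ _ /(_ 1%N (const_mx oneA)) pos.
have := pos _ (fun=> x); rewrite !big_ord1 mxE; apply.
exists (const_mx oneA) => i j; rewrite big_ord1 !mxE star_one.
by have [_ [_ [_ [one _]]]] := hA; case: (one oneA) => ->.
Qed.

(** Here [W] plays the role of psi(1)^{-1/2}, so conjugation by it turns the value at the unit into
    the identity. *)
Lemma ucp_normalize psi T W : CPG psi -> selfadjoint_inverses inner T W ->
  (forall x, T (T x) = psi oneA x) -> UCPG (fun a x => W (psi a (W x))).
Proof.
move=> [cp_psi inv_psi] TW TT; have adjW := selfadjoint_inverses_adjoint TW.
have [_ bW _ TK WK] := TW; split; first split.
- exact: cp_conjugate bW adjW cp_psi.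
- by move=> g a; rewrite inv_psi.
- by move=> x; rewrite -TT TK WK.
Qed.

(* Combines ||x|| = ||P^-1 P x|| <= N ||P x|| with ||P x||^2 <= <P x, x>, which
   holds since P <= 1. *)
Lemma invertible_pos_lower P : linear P -> invertible_op P ->
  (forall x, 0 <= inner (P x) x <= `|x| ^+ 2) ->
  exists2 M : C, 1 <= M & forall x, M^-1 * `|x| ^+ 2 <= inner (P x) x.
Proof.
move=> linP [W [/bounded_op_bound[N N1 hN] [PK _]]] hP.
have N0 : 0 < N := lt_le_trans ltr01 N1.
exists (N ^+ 2) => [|x]; first exact: exprn_ege1.
rewrite ler_pdivrMl ?exprn_gt0//.
have Px : `|P x| ^+ 2 <= inner (P x) x.
  rewrite -[X in _ <= X]mul1r; apply: (pos_op_norm_le hH) => // y.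
  by rewrite mul1r.
apply: (@le_trans _ _ (N ^+ 2 * `|P x| ^+ 2)); last by rewrite ler_wpM2l ?exprn_ge0 ?(ltW N0).
rewrite -exprMn ler_sqr ?nnegrE ?(mulr_ge0 (ltW N0))//.
by rewrite -{1}(PK x).
Qed.

(* Without the factor 1/2 the bound 1 - M^-1 on 1 - P could be 0, which
   [pos_op_sqrt] excludes. *)
Lemma pos_op_half_sqrt P (M : C) : linear P -> 1 <= M ->
  (forall x, M^-1 * `|x| ^+ 2 <= inner (P x) x <= `|x| ^+ 2) ->
  exists T W, selfadjoint_inverses inner T W /\ forall x, T (T x) = 2^-1 *: P x.
Proof.
move=> linP M1 hP; have M0 : 0 < M := lt_le_trans ltr01 M1.
have half0 : 0 <= 2^-1 :> C by rewrite invr_ge0 ler0n.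
have half_lt1 : 2^-1 < 1 :> C by rewrite invf_lt1 ?ltr0n// ltr1n.
(* [P / 2] is written as 1 - S with S = 1 - P / 2; the lower bound on [P] puts S below 1 - M^-1 / 2,
   which is less than 1. *)
have [||||T [W [TW TT]]] :=
    pos_op_sqrt hH (S := fun x => x - 2^-1 *: P x) (s := 1 - 2^-1 * M^-1).
- by move=> c x y; rewrite linP scalerBr scalerDr opprD addrACA !scalerA mulrC.
- by rewrite subr_gt0 (le_lt_trans _ half_lt1)// ler_piMr// invf_le1.
- by rewrite ltrBlDr ltrDl mulr_gt0 ?invr_gt0 ?ltr0n.
- move=> x; rewrite (ipBl hH) (ipZl hH) (ip_norm hH) subr_ge0.
  have /andP[P0 P1] := hP x; apply/andP; split.
    rewrite (le_trans _ P1)// ler_piMl//; last exact: ltW.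
    by rewrite (le_trans _ P0)// mulr_ge0 ?invr_ge0 ?(ltW M0)// exprn_ge0.
  by rewrite mulrBl mul1r lerD2l lerN2 -mulrA ler_wpM2l.
- by exists T, W; split=> // x; rewrite TT subKr.
Qed.

(** P = 2 T^2 with [T] invertible. This makes T_i^* T_i invertible from a lower bound on its
    quadratic form, without the adjoint of T_i^-1. *)
Lemma pos_op_invertible P (M : C) : linear P -> 1 <= M ->
  (forall x, M^-1 * `|x| ^+ 2 <= inner (P x) x <= `|x| ^+ 2) -> invertible_op P.
Proof.
move=> linP M1 hP.
have [T [W [[bT bW _ TK WK] TT]]] := pos_op_half_sqrt linP M1 hP.
have PE x : P x = 2 *: T (T x) by rewrite TT scalerA mulfV ?scale1r// pnatr_eq0.
exists (fun x => 2^-1 *: W (W x)); split.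
  by apply: bounded_op_scale; exact: bounded_op_comp.
split=> x; rewrite PE.
  by rewrite !(bounded_opZ bW) scalerA mulVf ?scale1r ?TK ?pnatr_eq0.
by rewrite !(bounded_opZ bT) scalerA mulfV ?scale1r ?WK ?pnatr_eq0.
Qed.

(** * Extremality gives the form of dominated maps: (1) implies (2) *)

Lemma extreme_dominated phi psi : UCPG phi ->
  cstar_extreme inner mulA oneA starA tau phi ->
  CPG psi -> cp_le inner mulA starA psi phi -> invertible_op (psi oneA) ->
  exists Z Zs : H -> H,
    [/\ bounded_op Z, invertible_op Z, is_adjoint inner Z Zs &
        forall a x, psi a x = Zs (phi a (Z x))].
Proof.
move=> [[cp_phi inv_phi] phi1] ext [cp_psi inv_psi] le_psi inv1.
pose P := psi oneA; pose chi a x := 2^-1 *: psi a x.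
have half0 : 0 <= 2^-1 :> C by rewrite invr_ge0 ler0n.
have half_lt1 : 2^-1 < 1 :> C by rewrite invf_lt1 ?ltr0n// ltr1n.
have bP : bounded_op P by case: cp_psi => /(_ oneA).
have linP : linear P by case: bP.
have hP x : 0 <= inner (P x) x <= `|x| ^+ 2.
  rewrite cp_one_ge0//= -subr_ge0 -(ip_norm hH) -(ipBl hH).
  by have := cp_one_ge0 x le_psi; rewrite phi1.
have cp_chi : CP chi by exact: cp_scale.
have G_chi : CPG chi by split=> // g a; rewrite /chi inv_psi.
have G_rest : CPG (fun a x => phi a x - chi a x).
  split; last by move=> g a; rewrite /chi inv_psi inv_phi.
  (* Since psi = 2 chi, the remainder phi - chi is the sum of the completely positive maps phi - psi
     and chi. *)
  rewrite (_ : (fun _ => _) = fun a x => (phi a x - psi a x) + chi a x).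
    exact: cp_add.
  apply/funext => a; apply/funext => x; rewrite -addrA; congr (_ + _).
  have -> : psi a x = chi a x + chi a x.
    by rewrite /chi -scalerDl -div1r -splitr scale1r.
  by rewrite opprD subrK.
have [T2 [W2 [TW2 TT2]]] : exists T W, selfadjoint_inverses inner T W /\
    forall x, T (T x) = x - chi oneA x.
  apply: (pos_op_sqrt hH (s := 2^-1)) => //.
  - by case: cp_chi => /(_ oneA)[].
  - move=> x; rewrite (ipZl hH); have /andP[P0 P1] := hP x.
    by rewrite mulr_ge0//= ler_wpM2l.
have [M M1 hM] := invertible_pos_lower linP inv1 hP.
have [|T1 [W1 [TW1 TT1]]] := pos_op_half_sqrt linP M1.
  by move=> x; rewrite hM; case/andP: (hP x).
have [bT1 bW1 adjT1 T1K W1K] := TW1; have [bT2 bW2 adjT2 T2K W2K] := TW2.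
(* Two-term families: index [0] carries [chi] and the other index phi - chi. The square roots are
   selfadjoint, so one family serves as both [T] and [Ts]. *)
pose sel (X : Type) (u v : X) (i : 'I_2) := if i == ord0 then u else v.
pose phi_1 a x := W1 (chi a (W1 x)).
pose phi_2 a x := W2 (phi a (W2 x) - chi a (W2 x)).
have inv_sel T W : selfadjoint_inverses inner T W -> invertible_op T.
  by case=> _ bW _ TK WK; exists W.
have [||||||U [Us [[bU adjU UK UsK] hU]]] :=
    ext 2%N (sel _ T1 T2) (sel _ T1 T2) (sel _ phi_1 phi_2) _ _ _ _ _ _ ord0.
- by move=> i; rewrite /sel; case: ifP.
- by move=> i; rewrite /sel; case: ifP.
- move=> i; rewrite /sel; case: ifP => _; [exact: inv_sel TW1|exact: inv_sel TW2].
- by move=> x; rewrite big_ord_recl big_ord1 /sel /= TT1 TT2 addrC subrK.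
- move=> i; rewrite /sel; case: ifP => _.
    exact: (ucp_normalize G_chi TW1 TT1).
  by apply: (ucp_normalize G_rest TW2) => x; rewrite TT2 phi1.
- move=> a x; rewrite big_ord_recl big_ord1 /sel /= /phi_1 /phi_2.
  by rewrite T1K W1K T2K W2K addrC subrK.
have bUs := bounded_op_adjoint hH bU adjU.
(* The scalar undoes the halving in [chi]: it occurs once in [Z] and once in its adjoint, unchanged
   there because it is real. *)
pose c : C := sqrtC 2.
have c0 : c != 0 by rewrite sqrtC_eq0 pnatr_eq0.
have cR : c^* = c by rewrite conj_Creal// ger0_real// sqrtC_ge0 ler0n.
exists (fun x => c *: U (T1 x)), (fun x => c *: T1 (Us x)); split.
- by apply: bounded_op_scale; exact: bounded_op_comp.
- exists (fun x => c^-1 *: W1 (Us x)); split.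
    by apply: bounded_op_scale; exact: bounded_op_comp.
  split=> x.
    by rewrite (bounded_opZ bUs) (bounded_opZ bW1) scalerA mulVf// scale1r UK T1K.
  by rewrite (bounded_opZ bT1) (bounded_opZ bU) scalerA mulfV// scale1r W1K UsK.
- by move=> x y; rewrite (ipZl hH) (ipZr hH) cR adjU adjT1.
- move=> a x; have [/(_ a) bphi _ _] := cp_phi.
  rewrite (bounded_opZ bphi) (bounded_opZ bUs) (bounded_opZ bT1) scalerA -expr2 sqrtCK.
  have := hU a (T1 x); rewrite /sel /= /phi_1 T1K => <-.
  by rewrite W1K /chi scalerA mulfV ?pnatr_eq0// scale1r.
Qed.

(** * The form of dominated maps gives extremality: (2) implies (1) *)

Lemma dominated_extreme phi : UCPG phi ->
  (forall psi, CPG psi -> cp_le inner mulA starA psi phi ->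
     invertible_op (psi oneA) ->
     exists Z Zs : H -> H,
       [/\ bounded_op Z, invertible_op Z, is_adjoint inner Z Zs &
           forall a x, psi a x = Zs (phi a (Z x))]) ->
  cstar_extreme inner mulA oneA starA tau phi.
Proof.
move=> [[cp_phi inv_phi] phi1] dom n T Ts phis bT adjT invT sumT ucp def_phi i.
pose psi a x := Ts i (phis i a (T i x)).
have cpF j : CP (fun a x => Ts j (phis j a (T j x))).
  by apply: (cp_conjugate (bT j) (adjT j)); case: (ucp j) => -[].
have [W [bW [TK WK]]] := invT i.
have phis1 x : phis i oneA x = x by case: (ucp i).
have adjTs := is_adjoint_sym (adjT i).
have le_psi : cp_le inner mulA starA psi phi.
  rewrite /cp_le (_ : (fun _ => _) =
      fun a x => \sum_(j < n | j != i) Ts j (phis j a (T j x))); first exact: cp_sum.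
  apply/funext => a; apply/funext => x.
  by rewrite def_phi (bigD1 i)//= addrC addrK.
have psi1 x : psi oneA x = Ts i (T i x) by rewrite /psi phis1.
have inv1 : invertible_op (psi oneA).
  have [N N1 hN] := bounded_op_bound bW.
  have N0 : 0 < N := lt_le_trans ltr01 N1.
  apply: (@pos_op_invertible _ (N ^+ 2)).
  - by have [/(_ oneA)[]] := cpF i.
  (* The constant is [N ^+ 2], with [N] a bound for the inverse [W] of [T i]: the norm of [x] is at
     most [N] times that of [T i x], whose square is [inner (psi oneA x) x]. *)
  - exact: exprn_ege1.
  - move=> x; apply/andP; split.
      rewrite psi1 adjTs (ip_norm hH) ler_pdivrMl ?exprn_gt0// -exprMn.
      by rewrite ler_sqr ?nnegrE ?(mulr_ge0 (ltW N0))// -{1}(TK x).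
    rewrite -subr_ge0 -(ip_norm hH) -(ipBl hH).
    by have := cp_one_ge0 x le_psi; rewrite phi1.
have [|Z [Zs [bZ [V [bV [ZK VK]]] adjZ psiE]]] := dom psi _ le_psi inv1.
  by split=> [|g a]; [exact: cpF|rewrite /psi; case: (ucp i) => -[_ ->]].
have ZZ x y : inner (Z x) (Z y) = inner (T i x) (T i y).
  rewrite adjZ adjT; congr (inner x _).
  by rewrite -[Z y]phi1 -psiE /psi phis1.
exists (fun x => Z (W x)), (fun x => T i (V x)).
(* Since Z^* Z = T_i^* T_i, the operator U = Z T_i^-1 is isometric and onto, so
   its inverse T_i Z^-1 is its adjoint; no adjoint of T_i^-1 is needed. *)
have adjU : is_adjoint inner (fun x => Z (W x)) (fun x => T i (V x)).
  by move=> x y; rewrite -{1}(VK y) ZZ WK.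
split; first split=> // [|x|x]; first exact: bounded_op_comp.
- by rewrite ZK WK.
- by rewrite TK VK.
(* Tested against [y], the right side becomes [inner (psi a (W x)) (W y)]; unfolding [psi] and
   moving [Ts i] across makes [T i] cancel [W] on both sides. *)
- move=> a x; apply: (ip_inj hH) => y.
  by rewrite (is_adjoint_sym adjU) -(is_adjoint_sym adjZ) -psiE /psi adjTs !WK.
Qed.

End CompletelyPositive.

Theorem theorem4p4 (R : realType)
  (A : completeNormedModType (Cplx R))
  (mulA : A -> A -> A) (oneA : A) (starA : A -> A)
  (hA : unital_cstar_algebra mulA oneA starA)
  (G : groupType) (tau : G -> A -> A)
  (htau : cstar_action mulA oneA starA tau)
  (H : completeNormedModType (Cplx R)) (inner : H -> H -> Cplx R)
  (hH : hilbert_inner inner)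
  (phi : A -> H -> H)
  (hphi : UCP_G inner mulA oneA starA tau phi) :
  cstar_extreme inner mulA oneA starA tau phi <->
  (forall psi : A -> H -> H,
     CP_G inner mulA starA tau psi ->
     cp_le inner mulA starA psi phi ->
     invertible_op (psi oneA) ->
     exists Z Zs : H -> H,
       [/\ bounded_op Z, invertible_op Z, is_adjoint inner Z Zs &
           forall a x, psi a x = Zs (phi a (Z x))]).
Proof.
split=> [ext psi|]; first exact: (extreme_dominated hH hA hphi ext).
exact: (dominated_extreme hH hA hphi).
Qed.
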